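(* Let $X$ be a finite nonempty set, let $\mathcal E^0$ be a collection of nonempty subsets of $X$, and for each $E\in\mathcal E^0$ let $\mu_E\colon 2^E\to[0,1]$ be a monotone set function with $\mu_E(\emptyset)=0$. Let $\mathbf G=\{G_E:E\in\mathcal E^0\}$ be either (a) the Choquet-generated family $G_E(u)=\mathrm{Ch}_{\mu_E}(u)$, $u\in[0,1]^E$, or (b) the smallest $\otimes$-based universal-integral family $G_E(u)=\mathrm I_{\otimes,\mu_E}(u)$, $u\in[0,1]^E$, for a semicopula $\otimes$. Then $\mathbf G$ is consistent under zero extension if and only if $\{\mu_E:E\in\mathcal E^0\}$ is projectively compatible. In particular, this equivalence holds for the Choquet integral, the Sugeno integral ($\otimes=\min$), and the Shilkret integral ($\otimes$ the product).
   Context: A set function $\mu\colon2^E\to[0,1]$ is monotone if $\mu(A)\le\mu(B)$ whenever $A\subseteq B\subseteq E$. For $u\in[0,1]^E$ and $t\in[0,1]$, $\{u\ge t\}=\{x\in E:u(x)\ge t\}$. Discrete Choquet integral: $\mathrm{Ch}_\mu(u)=\int_0^1\mu(\{u\ge t\})\,\mathrm dt$. A semicopula is an operation $\otimes\colon[0,1]^2\to[0,1]$, nondecreasing in each argument, with $1\otimes a=a\otimes1=a$ for all $a\in[0,1]$. The smallest $\otimes$-based universal integral is $\mathrm I_{\otimes,\mu}(u)=\sup_{t\in[0,1]}t\otimes\mu(\{u\ge t\})$. For $F\subseteq E$ and $v\in[0,1]^F$, $Z_{F,E}v\in[0,1]^E$ equals $v$ on $F$ and $0$ on $E\setminus F$.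 The family $\mathbf G$ is consistent under zero extension if $G_E(Z_{F,E}v)=G_F(v)$ for all $F\subseteq E$ in $\mathcal E^0$ and all $v\in[0,1]^F$. The family $\{\mu_E\}$ is projectively compatible if $\mu_E(B)=\mu_F(B)$ for every $B\subseteq F\subseteq E$ with $F,E\in\mathcal E^0$. *)

(* Defs.v *)
From HB Require Import structures.
From mathcomp Require Import all_boot all_order all_algebra.
From mathcomp Require Import all_classical all_reals all_analysis.

Set Implicit Arguments.
Unset Strict Implicit.
Unset Printing Implicit Defensive.

Import Order.TTheory GRing.Theory Num.Theory.
Import numFieldNormedType.Exports.

Local Open Scope ring_scope.

(* The elements of E as a finite type: [0,1]^E is then a set of functions
   on [carrier E], and 2^E is [{set carrier E}]. *)
Definition carrier (X : finType) (E : {set X}) : finType := {x : X | x \in E}.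

(* B, for B \subset E, seen as an element of 2^E. *)
Definition subset_in (X : finType) (E B : {set X}) : {set carrier E} :=
  [set x : carrier E | val x \in B]%SET.

Section OneCarrier.
Context {R : realType} {T : finType}.

Definition monotone_set_function (mu : {set T} -> R) : Prop :=
  (forall A : {set T}, 0 <= mu A <= 1) /\
  (forall A B : {set T}, A \subset B -> mu A <= mu B).

Definition unit_valued (u : T -> R) : Prop := forall x : T, 0 <= u x <= 1.

Definition upper_level (u : T -> R) (t : R) : {set T} :=
  [set x : T | t <= u x]%SET.

Definition choquet (mu : {set T} -> R) (u : T -> R) : R :=
  \int[lebesgue_measure]_(t in `[0, 1]%classic) mu (upper_level u t).

(* For [0,1]-valued mu and a semicopula op, the set below is nonempty and
   bounded, so that [sup] is a genuine supremum. *)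
Definition universal_integral (op : R -> R -> R)
    (mu : {set T} -> R) (u : T -> R) : R :=
  sup [set op t (mu (upper_level u t)) | t in `[0, 1]%classic]%classic.

Definition sugeno (mu : {set T} -> R) (u : T -> R) : R :=
  universal_integral Num.min mu u.

Definition shilkret (mu : {set T} -> R) (u : T -> R) : R :=
  universal_integral *%R mu u.

End OneCarrier.

(* An operation on [0,1]^2 is represented by a total function on R^2 whose
   values outside [0,1]^2 are irrelevant. *)
Definition semicopula (R : realType) (op : R -> R -> R) : Prop :=
  [/\ forall a b, 0 <= a <= 1 -> 0 <= b <= 1 -> 0 <= op a b <= 1,
      forall a a' b, 0 <= a -> a <= a' -> a' <= 1 -> 0 <= b <= 1 ->
        op a b <= op a' b,
      forall a b b', 0 <= a <= 1 -> 0 <= b -> b <= b' -> b' <= 1 ->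
        op a b <= op a b'
    & forall a, 0 <= a <= 1 -> op 1 a = a /\ op a 1 = a].

Section Families.
Context {R : realType} {X : finType}.

Definition zero_extension (F E : {set X}) (v : carrier F -> R)
    (x : carrier E) : R :=
  if insub (val x) is Some y then v y else 0.

(* Families are indexed by all subsets of X; only the members with index in
   E0 matter. *)
Definition zero_extension_consistent (E0 : {set {set X}})
    (G : forall E : {set X}, (carrier E -> R) -> R) : Prop :=
  forall F E : {set X}, F \in E0 -> E \in E0 -> F \subset E ->
  forall v : carrier F -> R, unit_valued v ->
    G E (@zero_extension F E v) = G F v.

Definition projectively_compatible (E0 : {set {set X}})
    (mu : forall E : {set X}, {set carrier E} -> R) : Prop :=
  forall B F E : {set X}, B \subset F -> F \subset E ->
    F \in E0 -> E \in E0 ->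
    mu E (subset_in E B) = mu F (subset_in F B).

End Families.

(* Main.v *)
(* Two properties of the integrals suffice: G_E(u) depends only on the numbers
   mu_E({u >= t}) with t > 0 (t = 0 is a null set for the Choquet integral, and
   contributes op 0 a = 0 to the supremum), and G_E(1_A) = mu_E(A).  For t > 0
   the upper level sets of v and of its zero extension are the same subset of X,
   so compatibility gives consistency; conversely, the zero extension of 1_B is
   1_B, so consistency on indicators is compatibility. *)
Require Import Defs.
From HB Require Import structures.
From mathcomp Require Import all_boot all_order all_algebra.
From mathcomp Require Import all_classical all_reals all_analysis.
From mathcomp Require Import measurable_realfun.

Import Order.TTheory GRing.Theory Num.Theory.
Local Open Scope ring_scope.

Lemma upper_level_subset (R : realType) (T : finType) (u : T -> R) (s t : R) :
  s <= t -> upper_level u t \subset upper_level u s.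
Proof.
by move=> st; apply/fintype.subsetP => x; rewrite !inE; exact: le_trans.
Qed.

Lemma upper_level_indicator (R : realType) (T : finType) (A : {set T}) (t : R) :
  0 < t <= 1 -> upper_level (fun x => (x \in A)%:R) t = A.
Proof.
case/andP=> t0 t1; apply/setP => x; rewrite !inE.
by case: (x \in A); rewrite ?t1// leNgt t0.
Qed.

(** Level sets shrink as [t] grows, so by monotonicity of [mu] the integrand of the Choquet integral
    is nonincreasing, hence Borel. *)
Lemma measurable_upper_level (R : realType) (T : finType) (mu : {set T} -> R)
    (u : T -> R) (D : set R) :
  monotone_set_function mu -> measurable D ->
  measurable_fun D (fun t => mu (upper_level u t)).
Proof.
move=> [_ mono] mD; apply: nonincreasing_measurable => // s t st.
exact/mono/upper_level_subset.
Qed.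

Lemma eq_choquet (R : realType) (T T' : finType) (mu : {set T} -> R)
    (mu' : {set T'} -> R) (u : T -> R) (u' : T' -> R) :
  monotone_set_function mu -> monotone_set_function mu' ->
  (forall t : R, 0 < t <= 1 -> mu (upper_level u t) = mu' (upper_level u' t)) ->
  choquet mu u = choquet mu' u'.
Proof.
move=> mmu mmu' eq_mu; rewrite /choquet /Rintegral; congr fine.
(* The endpoints of [[0, 1]] are null, so agreement on the open interval is enough. *)
apply: eq_integral_itv_bounded; [exact: measurable_upper_level..|].
by move=> t; rewrite in_itv/= => /andP[t0 t1]; rewrite eq_mu// t0 ltW.
Qed.

Lemma choquet_indicator (R : realType) (T : finType) (mu : {set T} -> R)
    (A : {set T}) :
  monotone_set_function mu -> choquet mu (fun x => (x \in A)%:R) = mu A.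
Proof.
(* The integrand is constantly [mu A] off the null point [t = 0], and [[0, 1]] has length 1. *)
move=> mmu; transitivity (\int[lebesgue_measure]_(t in `[0, 1]%classic) mu A).
  rewrite /choquet /Rintegral; congr fine.
  apply: eq_integral_itv_bounded => //; first exact: measurable_upper_level.
  move=> t; rewrite in_itv/= => /andP[t0 t1].
  by rewrite upper_level_indicator// t0 ltW.
rewrite Rintegral_cst//= lebesgue_measure_itv/= lte_fin ltr01.
by rewrite -EFinB/= subr0 mulr1.
Qed.

(** Monotonicity in the second argument gives [op 0 a <= op 0 1], and 1 is neutral. *)
Lemma semicopula0l (R : realType) (op : R -> R -> R) (a : R) :
  semicopula op -> 0 <= a <= 1 -> op 0 a = 0.
Proof.
move=> [op01 _ opr op1] /andP[a0 a1].
have z01 : 0 <= (0 : R) <= 1 by rewrite lexx ler01.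
have /andP[ge0 _] : 0 <= op 0 a <= 1 by apply: op01; rewrite ?a0.
apply/eqP; rewrite eq_le ge0 andbT -[leRHS](op1 0 z01).2.
exact: opr.
Qed.

Lemma eq_universal_integral (R : realType) (op : R -> R -> R) (T T' : finType)
    (mu : {set T} -> R) (mu' : {set T'} -> R) (u : T -> R) (u' : T' -> R) :
  semicopula op ->
  monotone_set_function mu -> monotone_set_function mu' ->
  (forall t : R, 0 < t <= 1 -> mu (upper_level u t) = mu' (upper_level u' t)) ->
  universal_integral op mu u = universal_integral op mu' u'.
Proof.
move=> sop [mu01 _] [mu'01 _] eq_mu; rewrite /universal_integral; congr sup.
apply: eq_imagel => t /=; rewrite in_itv/= => /andP[].
rewrite le_eqVlt => /predU1P[<- _|t0 t1]; first by rewrite !semicopula0l.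
by rewrite eq_mu// t0.
Qed.

(** The supremum is attained at [t = 1], where [op 1 (mu A) = mu A]; monotonicity in the first
    argument bounds the terms with [0 < t]. *)
Lemma universal_integral_indicator (R : realType) (op : R -> R -> R)
    (T : finType) (mu : {set T} -> R) (A : {set T}) :
  semicopula op -> monotone_set_function mu ->
  universal_integral op mu (fun x => (x \in A)%:R) = mu A.
Proof.
move=> sop [mu01 _]; have [op01 opl _ op1] := sop.
rewrite /universal_integral; set S := image _ _.
have S1 : S (mu A).
  exists 1; first by rewrite /= in_itv/= ler01 lexx.
  by rewrite upper_level_indicator ?ltr01 ?lexx// (op1 _ (mu01 A)).1.
have ubS : ubound S (mu A).
  move=> _ [t + <-]; rewrite /= in_itv/= => /andP[].
  rewrite le_eqVlt => /predU1P[<- _|t0 t1].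
    by rewrite semicopula0l//; case/andP: (mu01 A).
  rewrite upper_level_indicator ?t0// -[leRHS](op1 _ (mu01 A)).1.
  by apply: opl => //; exact: ltW.
apply/eqP; rewrite eq_le; apply/andP; split.
  (* [mu A] serves first as a witness that [S] is nonempty, then as an upper bound of [S]. *)
  by apply: ge_sup => //; exists (mu A).
by apply: ub_le_sup => //; exists (mu A).
Qed.

(** Every element of 2^F thus comes from a subset of [X], the form in which compatibility is
    stated. *)
Lemma subset_in_imset (X : finType) (F : {set X}) (A : {set carrier F}) :
  subset_in F (val @: A) = A.
Proof. by apply/setP => x; rewrite inE mem_imset//; exact: val_inj. Qed.

Lemma upper_level_zero_extension (R : realType) (X : finType) (F E : {set X})
    (v : carrier F -> R) (t : R) :
  0 < t ->
  upper_level (@zero_extension R X F E v) t =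
    subset_in E (val @: upper_level v t).
Proof.
move=> t0; apply/setP => x; rewrite !inE /zero_extension.
case: insubP => [y _ yx|xF].
  by rewrite -yx mem_imset ?inE//; exact: val_inj.
(* Outside [F] the extension is 0, below the level [t]; at [t = 0] such points would enter the level
   set. *)
rewrite leNgt t0/=; apply/esym/negP => /imsetP[y _ xy].
by move: xF; rewrite [val x]xy (valP y).
Qed.

Lemma zero_extension_indicator (R : realType) (X : finType) (F E B : {set X}) :
  B \subset F ->
  @zero_extension R X F E (fun x => (x \in subset_in F B)%:R) =
    (fun x => (x \in subset_in E B)%:R).
Proof.
move=> BF; apply/funext => x; rewrite /zero_extension inE.
case: insubP => [y _ yx|xF]; first by rewrite inE yx.
by rewrite [val x \in B](contraNF (fintype.subsetP BF _) xF).
Qed.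

(** The two hypotheses on [G] isolate what both kinds of integral share. The first compares
    functions on different carriers, as is needed for [v] and its zero extension. *)
Lemma consistent_iff_compatible (R : realType) (X : finType)
    (E0 : {set {set X}}) (mu : forall E : {set X}, {set carrier E} -> R)
    (G : forall E : {set X}, (carrier E -> R) -> R) :
  (forall E F u v, E \in E0 -> F \in E0 ->
    (forall t : R, 0 < t <= 1 -> mu E (upper_level u t) = mu F (upper_level v t)) ->
    G E u = G F v) ->
  (forall E (A : {set carrier E}), E \in E0 ->
    G E (fun x => (x \in A)%:R) = mu E A) ->
  zero_extension_consistent E0 G <-> projectively_compatible E0 mu.
Proof.
move=> eqG G1; split=> [cons B F E BF FE F0 E0E|comp F E F0 E0E FE v _].
  rewrite -!G1// -(zero_extension_indicator R X F E B BF) cons// => x.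
  by rewrite ler0n lern1 leq_b1.
apply: eqG => // t /andP[t0 _]; rewrite upper_level_zero_extension//.
(* Compatibility is applied with [B] the image in [X] of the level set of [v]. *)
rewrite (comp _ F)// ?subset_in_imset//.
by apply/fintype.subsetP => _ /imsetP[y _ ->]; exact: valP.
Qed.

Lemma semicopula_min (R : realType) : semicopula (Num.min : R -> R -> R).
Proof.
split.
- move=> a b /andP[a0 a1] /andP[b0 b1].
  by rewrite le_min a0 b0 ge_min a1.
- by move=> a a' b _ aa' _ _; rewrite le_min !ge_min lexx aa' orbT.
- by move=> a b b' _ _ bb' _; rewrite le_min !ge_min lexx bb' orbT.
- by move=> a /andP[_ a1]; rewrite (min_idPr a1) (min_idPl a1).
Qed.

Lemma semicopula_mul (R : realType) : semicopula ( *%R : R -> R -> R).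
Proof.
split.
- by move=> a b /andP[a0 a1] /andP[b0 b1]; rewrite mulr_ge0// mulr_ile1.
- by move=> a a' b _ aa' _ /andP[b0 _]; exact: ler_wpM2r.
- by move=> a b b' /andP[a0 _] _ bb' _; exact: ler_wpM2l.
- by move=> a _; rewrite mul1r mulr1.
Qed.

Theorem corollary6p4 (R : realType) (X : finType) (hX : (0 < #|X|)%N)
    (E0 : {set {set X}}) (hE0 : forall E : {set X}, E \in E0 -> E != finset.set0)
    (mu : forall E : {set X}, {set carrier E} -> R)
    (hmu : forall E : {set X}, E \in E0 -> monotone_set_function (mu E))
    (hmu0 : forall E : {set X}, E \in E0 -> mu E finset.set0 = 0) :
  [/\ zero_extension_consistent E0 (fun E => choquet (mu E))
        <-> projectively_compatible E0 mu,
      forall op : R -> R -> R, semicopula op ->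
        (zero_extension_consistent E0 (fun E => universal_integral op (mu E))
          <-> projectively_compatible E0 mu),
      zero_extension_consistent E0 (fun E => sugeno (mu E))
        <-> projectively_compatible E0 mu
    & zero_extension_consistent E0 (fun E => shilkret (mu E))
        <-> projectively_compatible E0 mu].
Proof.
have univ op : semicopula op ->
    zero_extension_consistent E0 (fun E => universal_integral op (mu E))
      <-> projectively_compatible E0 mu.
  move=> sop; apply: consistent_iff_compatible.
  - by move=> E F u v EE0 FE0; apply: eq_universal_integral => //; exact: hmu.
  - by move=> E A EE0; apply: universal_integral_indicator => //; exact: hmu.
(* [sugeno] and [shilkret] unfold to the universal integrals of [Num.min] and [*%R]. *)
split; [|exact: univ|exact/univ/semicopula_min|exact/univ/semicopula_mul].
apply: consistent_iff_compatible.
- by move=> E F u v EE0 FE0; apply: eq_choquet; exact: hmu.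
- by move=> E A EE0; apply: choquet_indicator; exact: hmu.
Qed.
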